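(* Let $x \in \mathbb{R}_+^2$ with $0 < x(1)+x(2) < 1$ and $x(1) > 0$, and set $x_n = \lfloor n x\rfloor$ (componentwise integer part). Then $$\frac{|P_{x_n}(\tau_n < \tau_0) - P_{T_n(x_n)}(\tau < \infty)|}{P_{x_n}(\tau_n < \tau_0)} = \frac{|P_{x_n}(\tau_n < \tau_0) - P_{x_n}(\bar\tau_n < \infty)|}{P_{x_n}(\tau_n < \tau_0)},$$ and this quantity decays exponentially in $n$; that is, there exist $c>0$ and $N>0$ such that it is at most $e^{-cn}$ for all $n > N$.
   Context: Let $\lambda,\mu_1,\mu_2>0$ with $\lambda+\mu_1+\mu_2=1$, $\lambda<\mu_1$, $\lambda<\mu_2$ and $\mu_1\neq\mu_2$. Let $I_1,I_2,\dots$ be i.i.d. with $P(I_k=(1,0))=\lambda$, $P(I_k=(-1,1))=\mu_1$, $P(I_k=(0,-1))=\mu_2$. $X$ is the constrained random walk on $\mathbb{Z}_+^2$: $X_{k+1}=X_k+\pi(X_k,I_k)$, where $\pi(x,v)=v$ if $x+v\in\mathbb{Z}_+^2$ and $\pi(x,v)=0$ otherwise. $\bar X$ is the walk on $\mathbb{Z}\times\mathbb{Z}_+$ driven by the same increments: $\bar X_{k+1}=\bar X_k+\pi_1(\bar X_k,I_k)$, where $\pi_1(x,v)=v$ if $x+v\in\mathbb{Z}\times\mathbb{Z}_+$ and $\pi_1(x,v)=0$ otherwise. Under $P_x$, $X_0=\bar X_0=x$. $\tau_n=\inf\{k: X_k(1)+X_k(2)=n\}$, $\tau_0=\inf\{k:X_k=(0,0)\}$,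 $\bar\tau_n=\inf\{k:\bar X_k(1)+\bar X_k(2)=n\}$. $T_n(x)=(n-x(1),x(2))$. $Y$ is the random walk on $\mathbb{Z}\times\mathbb{Z}_+$ with $Y_{k+1}=Y_k+\pi_1(Y_k,J_k)$, where the $J_k$ are i.i.d. with $P(J_k=(-1,0))=\lambda$, $P(J_k=(1,1))=\mu_1$, $P(J_k=(0,-1))=\mu_2$. $P_y(\tau<\infty)$ is the probability, for $Y_0=y$, that $\tau=\inf\{k: Y_k(1)=Y_k(2)\}$ is finite. *)

(* Defs.v *)
From HB Require Import structures.
From mathcomp Require Import all_boot all_order all_algebra finmap.
From mathcomp Require Import all_classical all_reals all_analysis.

Set Implicit Arguments.
Unset Strict Implicit.
Unset Printing Implicit Defensive.

Import Order.TTheory GRing.Theory Num.Theory.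
Import numFieldNormedType.Exports.

Local Open Scope classical_set_scope.
Local Open Scope ring_scope.

(* The integers carry the discrete sigma-algebra; [int * int] then gets the
   product sigma-algebra, which is again discrete. *)
HB.instance Definition _ := isPointed.Build int 0.
HB.instance Definition _ := @isMeasurable.Build default_measure_display
  int discrete_measurable discrete_measurable0
  discrete_measurableC discrete_measurableU.

(* All walks take values in Z^2; the constraint sets Z_+^2 and Z x Z_+ are
   predicates on it. *)
Notation site := (int * int)%type.

Definition quadrant : pred site := fun z => (0 <= z.1) && (0 <= z.2).
Definition upper_half : pred site := fun z => 0 <= z.2.

Section Independence.
Context d d' (Om : measurableType d) (E : measurableType d') (R : realType).
Context (P : probability Om R).

Definition mutually_independent (X : nat -> {RV P >-> E}) : Prop :=
  forall (s : {fset nat}) (A : nat -> set E),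
    (forall k, measurable (A k)) ->
    P (\bigcap_(k in [set` s]) (X k @^-1` A k)) =
    (\prod_(k <- s) P (X k @^-1` A k))%E.

End Independence.

(* The three masses are meant to sum to 1, so that they determine the common
   law of the steps. *)
Definition iid_steps d (Om : measurableType d) (R : realType)
    (P : probability Om R) (I : nat -> {RV P >-> site})
    (e0 e1 e2 : site) (p0 p1 p2 : R) : Prop :=
  mutually_independent I /\
  forall k, [/\ distribution P (I k) [set e0] = p0%:E,
                distribution P (I k) [set e1] = p1%:E &
                distribution P (I k) [set e2] = p2%:E].

Definition constrained_step (D : pred site) (z v : site) : site :=
  if D (z + v) then v else 0.

(* The steps are numbered from 0: [I k] leads from time [k] to time [k.+1]. *)
Fixpoint walk (Om : Type) (D : pred site) (I : nat -> Om -> site)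
    (z : site) (k : nat) (w : Om) : site :=
  if k is k'.+1 then
    let y := walk D I z k' w in y + constrained_step D y (I k' w)
  else z.

(* inf {k | X_k \in A}, equal to +oo when A is never reached *)
Definition hitting_time (R : realType) (Om : Type) (X : nat -> Om -> site)
    (A : set site) (w : Om) : \bar R :=
  ereal_inf [set (k%:R : R)%:E | k in [set k : nat | A (X k w)]].

Definition sum_line (n : nat) : set site := [set z | z.1 + z.2 = n%:Z].
Definition origin : set site := [set (0, 0)].
Definition diagonal : set site := [set z | z.1 = z.2].

Section Probabilities.
Context d (Om : measurableType d) (R : realType) (P : probability Om R).
Context (I : nat -> {RV P >-> site}).

(* P_z(tau_n < tau_0) for X *)
Definition prob_X (n : nat) (z : site) : R :=
  let X := walk quadrant (fun k => I k : Om -> site) z in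
  fine (P [set w | (hitting_time R X (sum_line n) w <
                    hitting_time R X origin w)%E]).

(* P_z(bar tau_n < oo) for bar X *)
Definition prob_barX (n : nat) (z : site) : R :=
  let X := walk upper_half (fun k => I k : Om -> site) z in
  fine (P [set w | (hitting_time R X (sum_line n) w < +oo)%E]).

(* P_z(tau < oo) for Y, when [I] is the sequence of steps J *)
Definition prob_Y (z : site) : R :=
  let Y := walk upper_half (fun k => I k : Om -> site) z in
  fine (P [set w | (hitting_time R Y diagonal w < +oo)%E]).

End Probabilities.

Definition T_ (n : nat) (z : site) : site := (n%:Z - z.1, z.2).

Definition scaled_floor (R : realType) (n : nat) (x : R * R) : site :=
  (Num.floor (n%:R * x.1), Num.floor (n%:R * x.2)).

(* Main.v *)
Require Import Defs.
From HB Require Import structures.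
From mathcomp Require Import all_boot all_order all_algebra finmap.
From mathcomp Require Import all_classical all_reals all_analysis.
From mathcomp Require Import ring lra zify.

Set Implicit Arguments.
Unset Strict Implicit.
Unset Printing Implicit Defensive.

Import Order.TTheory GRing.Theory Num.Theory.
Import numFieldNormedType.Exports.

Local Open Scope classical_set_scope.
Local Open Scope ring_scope.

(** Write [r1 = lambda / mu1], [r2 = lambda / mu2], [rho = max r1 r2] and
    [m = n - z.1 - z.2], the distance of a site [z] to the line that has to be
    reached.

    The equality of the two relative errors holds because [T_ n] maps the
    steps of [bar X] to those of [Y], preserves the constraint (which sees only
    the second coordinate) and sends the line to the diagonal. Hence both walks
    have the same probability of success within [k] steps for every [k]
    ([prob_YE]).

    The decay comes from the explicit function
      [f z = r2^m + r1^(z.2) * C * (r2^m - r1^m)],  [C = (mu2-lambda)/(mu1-mu2)]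
    (called [hit_barX] below), which has boundary value 1 on the line and is
    harmonic for [bar X], including on its constraining boundary. It even equals
    the hitting probability of [bar X] ([barX_limit]): [f] is dominated by a
    function that the one-step operator contracts by a factor smaller than 1
    ([lyap_barX]), so that paths which avoid the line contribute nothing.

    For [X] the same [f] is harmonic except on the axis [z.1 = 0], where the
    service of the empty first queue is suppressed. There [f] is subharmonic,
    and its defect is at most a constant times [rho^n]
    ([hit_barX_mean_quadrant]). Optional stopping at the first visit to the
    line or to the origin, where [f] is also of order [rho^n], gives
      [| P(tau_n < tau_0) - f | <= const * rho^n * (expected duration)].
    The expected duration is bounded by a Lyapunov function [L] with drift at
    most -1 off the origin, of size [const * beta^(-n)] with [beta < 1] as close
    to 1 as desired ([lyap_X], [X_limit_bounds]). On the other hand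
    [f z >= const * rho^(n - z.1)] ([hit_barX_ge]). So the relative error is at
    most [const * rho^(z.1) * beta^(-n)], where [z.1] is about [n * x.1], and
    [beta = rho^(x.1 / 2)] makes it exponentially small ([X_relative_error]).

    Expectations over paths are handled through the finite-horizon
    probabilities [reach_prob], computed by recursion on the horizon with the
    one-step operator [mean]; optional stopping becomes the induction of
    [reach_prob_le] and [reach_prob_ge]. The link with the measure [P] is
    [reach_prob_cvg]. *)

(** * Powers, limits and integer arithmetic *)

Lemma exprz_succ (R : realType) (x : R) m : 0 < x -> x ^ (m + 1) = x ^ m * x.
Proof. by move=> x0; rewrite expfzDr ?expr1z // gt_eqF. Qed.

Lemma exprz_pred (R : realType) (x : R) m : 0 < x -> x ^ (m - 1) = x ^ m / x.
Proof. by move=> x0; rewrite expfzDr ?exprN1 // gt_eqF. Qed.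

Lemma exists_expr_lt (R : realType) (beta e : R) : 0 < beta < 1 -> 0 < e ->
  exists N : nat, beta ^+ N < e.
Proof.
move=> /andP[b0 b1] e0.
have /cvgrPdist_lt/(_ _ e0)[N _ /(_ N (leqnn N))] : beta ^+ n @[n --> \oo] --> 0.
  by apply: cvg_expr; rewrite ger0_norm // ltW.
by rewrite /= sub0r normrN ger0_norm ?exprn_ge0 ?ltW // => ?; exists N.
Qed.

Lemma cvg_le_of_bound (R : realType) (u : nat -> R) (p c : R) :
  u @ \oo --> p -> (forall k, u k <= c) -> p <= c.
Proof. by move=> up uc; apply: (ler_cvg_to up (cvg_cst c)); apply: nearW. Qed.

Lemma cvg_ge_of_geometric (R : realType) (u : nat -> R) (p g h kap : R) :
  u @ \oo --> p -> 0 <= kap < 1 -> (forall k, g <= u k + kap ^+ k * h) ->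
  g <= p.
Proof.
move=> up /andP[k0 k1] gu.
have u'p : u k + kap ^+ k * h @[k --> \oo] --> p.
  rewrite -[p]addr0 -[X in _ + X](mul0r h); apply: cvgD => //.
  by apply: cvgMl; apply: cvg_expr; rewrite ger0_norm.
by apply: (ler_cvg_to (cvg_cst g) u'p); apply: nearW.
Qed.

(** Only the ratio of the error bound [E] to the approximation [f] is needed:
    if it is at most 1/2 then [p >= f / 2], so the error relative to [p] is at
    most twice the error relative to [f]. *)
Lemma relative_error (R : realType) (p f E s : R) : 0 < f -> `|p - f| <= E ->
  2 * E <= s * f -> 0 <= s <= 1 -> 0 < p /\ `|p - f| / p <= s.
Proof.
move=> f0; rewrite ler_norml => /andP[Ep pE] Es /andP[s0 s1].
have sf : s * f <= f by rewrite ler_piMl // ltW.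
have p0 : 0 < p by lra.
split=> //; rewrite ler_pdivrMr //.
have fp : f / 2 <= p by lra.
have : s * (f / 2) <= s * p by rewrite ler_wpM2l.
by rewrite ler_norml => sp; apply/andP; split; lra.
Qed.

Lemma int_ge0_cases (b : int) : 0 <= b -> b = 0 \/ 1 <= b.
Proof. by lia. Qed.

Lemma opp_step (a b : int) :
  [/\ - (a + 1) - b = - a - b - 1, - (a - 1) - (b + 1) = - a - b,
      - (a + 1) = - a - 1, - (a - 1) = - a + 1 &
      - a - (b - 1) = - a - b + 1].
Proof. by split; lia. Qed.

Lemma gap_ge0 (n x y : int) : x + y <= n -> 0 <= n - x - y.
Proof. by lia. Qed.

Lemma gap_gt0 (n x y : int) : x + y < n -> 1 <= n - x - y.
Proof. by lia. Qed.

Lemma gap_split (n x y : int) : n - x = n - x - y + y.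
Proof. by lia. Qed.

Lemma opp_gap (n x y : int) : - x - y = - n + (n - x - y).
Proof. by lia. Qed.

Lemma tail_step (a b : int) :
  [/\ b + (a + 1) + (a + 1) = b + a + a + 1 + 1,
      b + 1 + (a - 1) + (a - 1) = b + a + a - 1 &
      b - 1 + a + a = b + a + a - 1].
Proof. by split; lia. Qed.

(** * Hitting events of a driven path *)

Lemma add_constrained_stepE (D : pred site) z v :
  z + constrained_step D z v = if D (z + v) then z + v else z.
Proof. by rewrite /constrained_step; case: ifP => _ //; rewrite addr0. Qed.

Lemma site_addE (a b a' b' : int) : (a, b) + (a', b') = (a + a', b + b').
Proof. by []. Qed.

(** Success within [k] steps, by recursion from the first step: this is the
    form of the event that conditioning on the first step can process. The test
    of [B] comes before that of [A], since reaching both at once does not make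
    one hitting time strictly smaller than the other. *)
Fixpoint reach (D A B : pred site) (s : nat -> site) (k : nat) (z : site) :
    bool :=
  ~~ B z && (A z ||
    (if k is k'.+1 then
       reach D A B (fun j => s j.+1) k' (z + constrained_step D z (s 0%N))
     else false)).

Lemma walk_front (Om : Type) (D : pred site) (I : nat -> Om -> site) z k w :
  walk D I z k.+1 w =
  walk D (fun j => I j.+1) (z + constrained_step D z (I 0%N w)) k w.
Proof.
elim: k => [//|k IH].
by rewrite -[LHS]/(let y := walk D I z k.+1 w in
  y + constrained_step D y (I k.+1 w)) /= -/(walk D I z k.+1 w) IH.
Qed.

Lemma reachP (Om : Type) (D A B : pred site) (I : nat -> Om -> site) k z w :
  reflect (exists2 j, (j <= k)%N & A (walk D I z j w) /\
             forall i, (i <= j)%N -> ~~ B (walk D I z i w))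
          (reach D A B (fun j => I j w) k z).
Proof.
elim: k I z => [|k IH] I z /=.
  apply: (iffP andP) => [[nB]|[j]].
    by rewrite orbF => Az; exists 0%N => //; split=> // -[|].
  by rewrite leqn0 => /eqP -> [Az nB]; rewrite Az (nB 0%N).
apply: (iffP andP) => [[nB /orP[Az|]]|[[|j] jk [Aj nB]]].
- by exists 0%N => //; split=> // -[|].
- move=> /(IH (fun j => I j.+1))[j jk [Aj nBj]]; exists j.+1 => //.
  rewrite walk_front; split=> // -[//|i] ij.
  by rewrite walk_front; exact: nBj.
- by split; [exact: (nB 0%N)|rewrite Aj].
split; first exact: (nB 0%N).
apply/orP; right; apply/(IH (fun j => I j.+1)); exists j => //.
rewrite -walk_front; split=> // i ij.
by rewrite -walk_front; exact: nB.
Qed.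

Lemma hitting_time_lt (R : realType) (Om : Type) (X : nat -> Om -> site)
    (A B : set site) w :
  (hitting_time R X A w < hitting_time R X B w)%E <->
  exists2 j, A (X j w) & forall i, (i <= j)%N -> ~ B (X i w).
Proof.
split=> [/ereal_inf_lt[_ [j Aj <-] jB]|[j Aj nB]].
  exists j => // i ij Bi; move: jB; apply/negP; rewrite -leNgt.
  apply: (@le_trans _ _ (i%:R)%:E); last by rewrite lee_fin ler_nat.
  by apply: ereal_inf_lbound; exists i.
apply: (@le_lt_trans _ _ (j%:R)%:E).
  by apply: ereal_inf_lbound; exists j.
apply: (@lt_le_trans _ _ (j.+1%:R)%:E); first by rewrite lte_fin ltr_nat.
apply: le_ereal_inf_tmp => _ [i Bi <-]; rewrite lee_fin ler_nat ltnNge.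
by apply/negP => /nB.
Qed.

Lemma hitting_time_fin (R : realType) (Om : Type) (X : nat -> Om -> site)
    (A : set site) w :
  (hitting_time R X A w < +oo)%E <-> exists j, A (X j w).
Proof.
split=> [/ereal_inf_lt[_ [j Aj <-] _]|[j Aj]]; first by exists j.
apply: (@le_lt_trans _ _ (j%:R)%:E); last exact: ltry.
by apply: ereal_inf_lbound; exists j.
Qed.

(** * The one-step operator and finite-horizon probabilities *)

(** A step law is encoded as the list of its atoms with their masses. *)
Section Mean.
Context (R : realType).
Implicit Types (nu : seq (site * R)) (D A B : pred site) (g h : site -> R).

Definition mean nu D g (z : site) : R :=
  \sum_(s <- nu) s.2 * g (z + constrained_step D z s.1).

Fixpoint reach_prob nu D A B (k : nat) (z : site) : R :=
  if B z then 0 else if A z then 1 else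
  if k is k'.+1 then mean nu D (reach_prob nu D A B k') z else 0.

Lemma mean_lin nu D g h (c : R) z :
  mean nu D (fun y => g y + c * h y) z =
  mean nu D g z + c * mean nu D h z.
Proof.
rewrite /mean mulr_sumr -big_split; apply: eq_bigr => s _ /=.
by rewrite mulrDr mulrCA.
Qed.

End Mean.

Lemma measurable_site (S : set site) : measurable S.
Proof.
apply: countable_measurable; last exact: countableP.
move=> z; have -> : [set z] = [set z.1] `*` [set z.2].
  apply/seteqP; split=> [y -> //|y [/= z1 z2]].
  by apply/pair_eqP; rewrite /= z1 z2 !eqxx.
exact: measurableX.
Qed.

(** * From independent steps to finite-horizon probabilities *)

Section Law.
Context d (Om : measurableType d) (R : realType) (P : probability Om R).
Context (nu : seq (site * R)) (I : nat -> {RV P >-> site}).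
Context (nu_uniq : uniq (unzip1 nu)).
Context (nu1 : \sum_(s <- nu) s.2 = 1).
Context (I_indep : mutually_independent I).
Context (I_law :
  forall k s, s \in nu -> P (I k @^-1` [set s.1]) = (s.2)%:E).

Lemma measurable_step k (S : set site) : measurable (I k @^-1` S).
Proof.
rewrite -[_ @^-1` _]setTI; apply: measurable_funP => //.
exact: measurable_site.
Qed.

Lemma measurable_reach D A B i k z :
  measurable [set w | reach D A B (fun j => I (i + j)%N w) k z].
Proof.
elim: k i z => [|k IH] i z /=.
  by case: (_ && _); rewrite ?set_true ?set_false.
case: (B z) => /=; first by rewrite set_false.
case: (A z) => /=; first by rewrite set_true.
rewrite [X in measurable X](_ : _ = \bigcup_v (I i @^-1` [set v] `&`
   [set w | reach D A B (fun j => I (i.+1 + j)%N w) k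
              (z + constrained_step D z v)])).
  apply: countable_bigcupT_measurable => [|v]; first exact: countableP.
  by apply: measurableI => //; exact: measurable_step.
have shift w v : reach D A B (fun j => I (i + j.+1)%N w) k v =
    reach D A B (fun j => I (i.+1 + j)%N w) k v.
  by congr reach; apply/funext => j; rewrite addnS.
apply/seteqP; split=> [w /= wr|w [v _ [/= <-]]].
  by exists (I i w) => //; split=> //=; rewrite -shift -{2}(addn0 i).
by rewrite shift addn0.
Qed.

(** The events [I k = s.1] are disjoint and their masses add up to 1, so what
    lies outside them is negligible. *)
Lemma measure_split k (E : set Om) : measurable E ->
  P E = (\sum_(s <- nu) P (E `&` (I k @^-1` [set s.1])))%E.
Proof.
move=> mE.
have mI S : measurable (I k @^-1` S) by exact: measurable_step.
have split_in (F : set Om) vs : measurable F -> uniq vs ->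
    P (F `&` (I k @^-1` [set` vs])) =
    (\sum_(v <- vs) P (F `&` (I k @^-1` [set v])))%E.
  move=> mF; elim: vs => [_|v vs IH /= /andP[vvs uvs]].
    by rewrite big_nil set_nil preimage_set0 setI0 measure0.
  have -> : [set` v :: vs] = [set v] `|` [set` vs].
    apply/seteqP; split=> y /=; first by rewrite inE => /orP[/eqP|]; [left|right].
    by case=> [->|yvs]; rewrite inE ?eqxx ?yvs ?orbT.
  rewrite big_cons -IH // preimage_setU setIUr measureU //.
  - exact: measurableI.
  - exact: measurableI.
  - rewrite setIACA setIid -preimage_setI.
    rewrite (_ : [set v] `&` [set` vs] = set0) ?preimage_set0 ?setI0 //.
    by apply/seteqP; split=> // y [/= ->]; rewrite (negPf vvs).
rewrite -(big_map fst xpredT (fun v => P (E `&` (I k @^-1` [set v])))).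
rewrite -split_in // (measureDI _ mE (mI [set` unzip1 nu])).
rewrite [X in (X + _)%E](_ : _ = 0%E) ?add0e //.
apply/eqP; rewrite -measure_le0.
have -> : 0%E = P (~` (I k @^-1` [set` unzip1 nu])).
  rewrite probability_setC //.
  rewrite -[X in P X]setTI split_in // big_map.
  rewrite (eq_big_seq (fun s => (s.2)%:E)); last first.
    by move=> s snu; rewrite setTI; exact: I_law.
  by rewrite sumEFin nu1 subee.
apply: le_measure; rewrite ?inE //; first exact: measurableD.
exact: measurableC.
Qed.

Definition cylinder (c : seq (site * R)) : set Om :=
  [set w | forall j, (j < size c)%N -> I j w = nth 0 (unzip1 c) j].

Lemma cylinderE c :
  cylinder c = \bigcap_(k in [set` [fset j in iota 0 (size c)]%fset])
                 (I k @^-1` [set nth 0 (unzip1 c) k]).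
Proof.
apply/seteqP; split=> w wc j.
  by rewrite /= !inE mem_iota /= add0n => /wc.
by move=> jc; apply: wc; rewrite /= !inE mem_iota.
Qed.

Lemma prob_cylinder c : {subset c <= nu} ->
  P (cylinder c) = (\prod_(s <- c) s.2)%:E.
Proof.
move=> cnu; rewrite cylinderE I_indep; last by move=> k; exact: measurable_site.
rewrite (perm_big (iota 0 (size c))) /=; last first.
  by apply: uniq_perm; rewrite ?iota_uniq ?fset_uniq // => j; rewrite !inE.
rewrite (eq_big_seq (fun k => ((nth 0 (unzip2 c) k)%:E))); last first.
  move=> k; rewrite mem_iota add0n => /andP[_ kc].
  rewrite (nth_map (0, 0)) // (nth_map (0, 0)) //.
  by apply: I_law; apply: cnu; rewrite mem_nth.
have -> : \prod_(s <- c) s.2 = \prod_(k <- iota 0 (size c)) nth 0 (unzip2 c) k.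
  by rewrite -(big_map snd xpredT id) (big_nth 0) size_map /index_iota subn0.
by elim/big_rec2: _ => // k x y _ ->.
Qed.

Lemma measurable_cylinder c : measurable (cylinder c).
Proof.
rewrite cylinderE; apply: fin_bigcap_measurable => [|k _].
  exact: finite_fset.
exact: measurable_step.
Qed.

Lemma nth_unzip1_rcons (c : seq (site * R)) s j :
  nth 0 (unzip1 (rcons c s)) j =
  if (j < size c)%N then nth 0 (unzip1 c) j
  else if j == size c then s.1 else 0.
Proof. by rewrite /unzip1 map_rcons nth_rcons size_map. Qed.

Lemma cylinder_rcons c s :
  cylinder (rcons c s) = cylinder c `&` (I (size c) @^-1` [set s.1]).
Proof.
apply/seteqP; split=> w.
  move=> wc; split=> [j jc|/=].
    rewrite wc ?size_rcons; last exact: ltnW.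
    by rewrite nth_unzip1_rcons jc.
  by rewrite wc ?size_rcons // nth_unzip1_rcons ltnn eqxx.
move=> [wc ws] j; rewrite size_rcons ltnS leq_eqVlt => /predU1P[->|jc].
  by rewrite [LHS]ws nth_unzip1_rcons ltnn eqxx.
by rewrite wc // nth_unzip1_rcons jc.
Qed.

(** The Markov property. Keeping a cylinder [c] of past steps in the statement
    makes the induction on the horizon close: conditioning on the next step
    lengthens the cylinder by one. *)
Lemma prob_cylinder_reach D A B k c z : {subset c <= nu} ->
  P (cylinder c `&` [set w | reach D A B (fun j => I (size c + j)%N w) k z]) =
  ((\prod_(s <- c) s.2) * reach_prob nu D A B k z)%:E.
Proof.
elim: k c z => [|k IH] c z cnu /=.
  case: (B z) => /=; first by rewrite set_false setI0 measure0 mulr0.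
  rewrite orbF; case: (A z); rewrite ?set_true ?set_false.
    by rewrite setIT prob_cylinder // mulr1.
  by rewrite setI0 measure0 mulr0.
have := measurable_reach D A B (size c) k.+1 z; rewrite /=.
case: (B z) => /= [_|]; first by rewrite set_false setI0 measure0 mulr0.
case: (A z) => /= [_|mE]; first by rewrite set_true setIT prob_cylinder // mulr1.
rewrite (measure_split (size c)); last first.
  by apply: measurableI mE; exact: measurable_cylinder.
rewrite /mean mulr_sumr -sumEFin; apply: eq_big_seq => s snu.
have := IH (rcons c s) (z + constrained_step D z s.1).
rewrite big_rcons /= mulrA => <-; last first.
  by move=> t; rewrite mem_rcons inE => /predU1P[->|/cnu].
rewrite cylinder_rcons -!setIA; congr (P (_ `&` _)).
have shift w v : reach D A B (fun j => I (size c + j.+1)%N w) k v =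
    reach D A B (fun j => I ((size c).+1 + j)%N w) k v.
  by congr reach; apply/funext => j; rewrite addnS.
rewrite setIC size_rcons; apply/seteqP; split=> w [/= ws].
  by rewrite shift addn0 ws.
by rewrite shift addn0 ws.
Qed.

(** Success happens at a finite time, so its probability is the increasing limit
    of the finite-horizon ones. *)
Lemma reach_prob_cvg D A B z :
  (fun k => reach_prob nu D A B k z) @ \oo -->
  fine (P [set w | exists2 j, A (walk D (fun k => I k : Om -> site) z j w) &
    forall i, (i <= j)%N -> ~~ B (walk D (fun k => I k : Om -> site) z i w)]).
Proof.
pose F k := [set w | reach D A B (fun j => I j w) k z].
have mF k : measurable (F k) by exact: (measurable_reach D A B 0 k z).
have PF k : P (F k) = (reach_prob nu D A B k z)%:E.
  have := @prob_cylinder_reach D A B k [::] z; rewrite big_nil mul1r => <- //.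
  by rewrite (_ : cylinder [::] = setT) ?setTI //; apply/seteqP; split.
set E := [set w | _].
have EF : E = \bigcup_k F k.
  apply/seteqP; split=> [w [j Aj nB]|w [k _ /(reachP _ _ _ I)[j _ [Aj nB]]]].
    by exists j => //; apply/(reachP _ _ _ I); exists j.
  by exists j.
rewrite EF.
have : P (F k) @[k --> \oo] --> P (\bigcup_k F k).
  apply: nondecreasing_cvg_mu => //; first exact: bigcupT_measurable.
  move=> k l kl; apply/subsetPset => w /(reachP _ _ _ I)[j jk Aj].
  by apply/(reachP _ _ _ I); exists j => //; exact: leq_trans kl.
have <- : ((fine (P (\bigcup_k F k)))%:E = P (\bigcup_k F k))%E.
  by rewrite fineK // fin_num_measure //; exact: bigcupT_measurable.
under eq_cvg do rewrite PF.
by move/fine_cvgP => [_].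
Qed.

End Law.

Section IidSteps.
Context d (Om : measurableType d) (R : realType) (P : probability Om R).
Context (I : nat -> {RV P >-> site}) (e0 e1 e2 : site) (p0 p1 p2 : R).
Context (hI : iid_steps I e0 e1 e2 p0 p1 p2) (psum : p0 + p1 + p2 = 1).
Context (e_uniq : uniq [:: e0; e1; e2]).
Let nu := [:: (e0, p0); (e1, p1); (e2, p2)].

Lemma iid_reach_prob_cvg D A B z :
  (fun k => reach_prob nu D A B k z) @ \oo -->
  fine (P [set w | exists2 j, A (walk D (fun k => I k : Om -> site) z j w) &
    forall i, (i <= j)%N -> ~~ B (walk D (fun k => I k : Om -> site) z i w)]).
Proof.
apply: reach_prob_cvg => //; first by rewrite /nu !big_cons big_nil addr0 addrA.
- by case: hI.
- move=> k s; have [_ /(_ k)[h0 h1 h2]] := hI.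
  by rewrite !inE => /or3P[] /eqP ->.
Qed.

Lemma prob_X_cvg n z :
  (fun k => reach_prob nu quadrant [pred y | y.1 + y.2 == n%:Z] (pred1 (0, 0)) k z)
    @ \oo --> prob_X I n z.
Proof.
rewrite /prob_X; set E := [set w | _].
rewrite (_ : E = [set w | exists2 j,
   [pred y | y.1 + y.2 == n%:Z]
     (walk quadrant (fun k => I k : Om -> site) z j w) &
   forall i, (i <= j)%N ->
     ~~ pred1 (0, 0) (walk quadrant (fun k => I k : Om -> site) z i w)]).
  exact: iid_reach_prob_cvg.
apply/seteqP; split=> w /=.
  move/hitting_time_lt => [j Aj nB]; exists j; first exact/eqP.
  by move=> i /nB ij; apply/eqP.
move=> [j /eqP Aj nB]; apply/hitting_time_lt; exists j => // i /nB.
by move/eqP.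
Qed.

Lemma prob_barX_cvg n z :
  (fun k => reach_prob nu upper_half [pred y | y.1 + y.2 == n%:Z] pred0 k z)
    @ \oo --> prob_barX I n z.
Proof.
rewrite /prob_barX; set E := [set w | _].
rewrite (_ : E = [set w | exists2 j,
   [pred y | y.1 + y.2 == n%:Z]
     (walk upper_half (fun k => I k : Om -> site) z j w) &
   forall i, (i <= j)%N ->
     ~~ pred0 (walk upper_half (fun k => I k : Om -> site) z i w)]).
  exact: iid_reach_prob_cvg.
apply/seteqP; split=> w /=.
  by move/hitting_time_fin => [j Aj]; exists j => //; apply/eqP.
by move=> [j /eqP Aj _]; apply/hitting_time_fin; exists j.
Qed.

Lemma prob_Y_cvg z :
  (fun k => reach_prob nu upper_half [pred y | y.1 == y.2] pred0 k z)
    @ \oo --> prob_Y I z.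
Proof.
rewrite /prob_Y; set E := [set w | _].
rewrite (_ : E = [set w | exists2 j,
   [pred y | y.1 == y.2] (walk upper_half (fun k => I k : Om -> site) z j w) &
   forall i, (i <= j)%N ->
     ~~ pred0 (walk upper_half (fun k => I k : Om -> site) z i w)]).
  exact: iid_reach_prob_cvg.
apply/seteqP; split=> w /=.
  by move/hitting_time_fin => [j Aj]; exists j => //; apply/eqP.
by move=> [j /eqP Aj _]; apply/hitting_time_fin; exists j.
Qed.

End IidSteps.

(** * Identification of the two limit walks *)

(** [T_ n] conjugates the dynamics because the constraint of the upper half
    plane only sees the second coordinate, which [T_ n] leaves alone. *)
Lemma T_step n z (v : site) :
  T_ n (z + constrained_step upper_half z v) =
  T_ n z + constrained_step upper_half (T_ n z) (- v.1, v.2).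
Proof.
rewrite /constrained_step /upper_half /T_ /=.
by case: ifP => _ /=; apply/pair_eqP/andP; split; apply/eqP => /=; lia.
Qed.

Lemma prob_YE d d' (Om : measurableType d) (Om' : measurableType d')
    (R : realType) (P : probability Om R) (Q : probability Om' R)
    (I : nat -> {RV P >-> site}) (J : nat -> {RV Q >-> site})
    (p0 p1 p2 : R) :
  p0 + p1 + p2 = 1 ->
  iid_steps I (1, 0) (-1, 1) (0, -1) p0 p1 p2 ->
  iid_steps J (-1, 0) (1, 1) (0, -1) p0 p1 p2 ->
  forall n z, prob_Y J (T_ n z) = prob_barX I n z.
Proof.
move=> p1E hI hJ n z.
have diagE y : ((T_ n y).1 == (T_ n y).2) = (y.1 + y.2 == n%:Z).
  by rewrite /T_ /= subr_eq addrC eq_sym.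
have reachE k : forall y,
    reach_prob [:: ((-1, 0), p0); ((1, 1), p1); ((0, -1), p2)] upper_half
      [pred y | y.1 == y.2] pred0 k (T_ n y) =
    reach_prob [:: ((1, 0), p0); ((-1, 1), p1); ((0, -1), p2)] upper_half
      [pred y | y.1 + y.2 == n%:Z] pred0 k y.
  elim: k => [|k IH] y; rewrite [LHS]/= [RHS]/= diagE //.
  case: ifP => // _; rewrite /mean !big_cons !big_nil -!IH.
  by rewrite !T_step /= opprK oppr0.
have := prob_Y_cvg hJ p1E isT (z := T_ n z).
under eq_cvg do rewrite reachE.
by move/cvg_unique; apply=> //; exact: prob_barX_cvg.
Qed.

(** * Comparison with sub- and superharmonic functions *)

Section Comparison.
Context (R : realType) (nu : seq (site * R)) (D A B : pred site).
Context (nu_ge0 : forall s, s \in nu -> 0 <= s.2).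
Context (G : pred site).
Context (G_step : forall z s, G z -> ~~ A z -> ~~ B z -> s \in nu ->
   G (z + constrained_step D z s.1)).

Lemma le_mean (g h : site -> R) z : G z -> ~~ A z -> ~~ B z ->
  (forall y, G y -> g y <= h y) -> mean nu D g z <= mean nu D h z.
Proof.
move=> Gz Az Bz gh; rewrite /mean !(big_seq_cond xpredT).
apply: ler_sum => s /andP[snu _].
by apply: ler_wpM2l; [exact: nu_ge0|apply: gh; exact: G_step].
Qed.

(** A nonnegative superharmonic function that is at least 1 on the target
    dominates the success probability. The region [G] is where the function is
    under control; the walk stays in it until it stops. *)
Lemma reach_prob_le (psi : site -> R) :
  (forall z, G z -> 0 <= psi z) ->
  (forall z, G z -> A z -> 1 <= psi z) ->
  (forall z, G z -> ~~ A z -> ~~ B z -> mean nu D psi z <= psi z) ->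
  forall k z, G z -> reach_prob nu D A B k z <= psi z.
Proof.
move=> psi0 psi1 psiS; elim=> [|k IH] z Gz /=.
  by case: ifP => _; [exact: psi0|case: ifP => [/psi1|_]; [exact|exact: psi0]].
case: ifPn => Bz; first exact: psi0.
case: ifPn => Az; first exact: psi1.
by apply: le_trans (psiS z Gz Az Bz); exact: le_mean.
Qed.

(** A subharmonic [g] with the right boundary values is at most the success
    probability plus the contribution of the paths still running at time [k].
    That contribution is at most [kap ^+ k * h] as soon as the one-step operator
    contracts a majorant [h] of [g] by the factor [kap]. *)
Lemma reach_prob_ge (g h : site -> R) (kap : R) : 0 <= kap ->
  (forall z, G z -> 0 <= h z) -> (forall z, G z -> g z <= h z) ->
  (forall z, G z -> A z -> g z <= 1) -> (forall z, G z -> B z -> g z <= 0) ->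
  (forall z, G z -> ~~ A z -> ~~ B z -> g z <= mean nu D g z) ->
  (forall z, G z -> ~~ A z -> ~~ B z -> mean nu D h z <= kap * h z) ->
  forall k z, G z -> g z <= reach_prob nu D A B k z + kap ^+ k * h z.
Proof.
move=> kap0 h0 gh gA gB gS hS k.
have kh z : G z -> 0 <= kap ^+ k * h z.
  by move=> Gz; rewrite mulr_ge0 ?exprn_ge0 ?h0.
elim: k kh => [|k IH] kh z Gz /=.
  case: ifPn => Bz; first by rewrite add0r mul1r gh.
  case: ifPn => Az; last by rewrite add0r mul1r gh.
  by rewrite -[leLHS]addr0 lerD ?gA // mul1r h0.
case: ifPn => Bz; first by rewrite add0r (le_trans (gB _ Gz Bz)) ?kh.
case: ifPn => Az; first by rewrite -[leLHS]addr0 lerD ?gA ?kh.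
apply: (le_trans (gS z Gz Az Bz)).
have {}IH y : G y -> g y <= reach_prob nu D A B k y + kap ^+ k * h y.
  by apply: IH => x Gx; rewrite mulr_ge0 ?exprn_ge0 ?h0.
apply: (le_trans (le_mean Gz Az Bz IH)).
rewrite /mean (eq_bigr (fun s : site * R =>
    s.2 * reach_prob nu D A B k (z + constrained_step D z s.1) +
    kap ^+ k * (s.2 * h (z + constrained_step D z s.1)))); last first.
  by move=> s _; rewrite mulrDr; congr (_ + _); rewrite mulrCA.
rewrite big_split lerD2l -mulr_sumr exprSr -mulrA ler_wpM2l ?exprn_ge0 //.
exact: hS.
Qed.

End Comparison.

(** * Harmonic and Lyapunov functions of the tandem walk *)

Section Tandem.
Context (R : realType) (l m1 m2 : R).
Context (l_gt0 : 0 < l) (m1_gt0 : 0 < m1) (m2_gt0 : 0 < m2).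
Context (sum1 : l + m1 + m2 = 1) (lm1 : l < m1) (lm2 : l < m2) (m12 : m1 != m2).

Definition tandem_law : seq (site * R) :=
  [:: ((1, 0), l); ((-1, 1), m1); ((0, -1), m2)].
Local Notation nu := tandem_law.

Lemma m1_lt1 : m1 < 1.
Proof. by move: sum1 l_gt0 m2_gt0; lra. Qed.

Lemma mean_upper (g : site -> R) a b : 0 <= b ->
  mean nu upper_half g (a, b) = l * g (a + 1, b) + m1 * g (a - 1, b + 1) +
    m2 * (if 1 <= b then g (a, b - 1) else g (a, b)).
Proof.
move=> b0; rewrite /mean !big_cons big_nil !add_constrained_stepE !site_addE.
rewrite /upper_half /=.
rewrite !addr0 b0 (_ : 0 <= b + 1); last by lia.
by rewrite subr_ge0 addrA; case: ifP.
Qed.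

Lemma mean_quadrant (g : site -> R) a b : 0 <= a -> 0 <= b ->
  mean nu quadrant g (a, b) = l * g (a + 1, b) +
    m1 * (if 1 <= a then g (a - 1, b + 1) else g (a, b)) +
    m2 * (if 1 <= b then g (a, b - 1) else g (a, b)).
Proof.
move=> a0 b0; rewrite /mean !big_cons big_nil !add_constrained_stepE.
rewrite !site_addE /quadrant /=.
rewrite !addr0 b0 a0 (_ : 0 <= a + 1) /=; last by lia.
rewrite (_ : 0 <= b + 1) ?andbT; last by lia.
by rewrite !subr_ge0 addrA; do 2!case: ifP.
Qed.

Let r1 := l / m1.
Let r2 := l / m2.
Let rho := Num.max r1 r2.
Let C := (m2 - l) / (m1 - m2).

Lemma r1_01 : 0 < r1 < 1.
Proof. by rewrite divr_gt0 //= ltr_pdivrMr // mul1r. Qed.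

Lemma r2_01 : 0 < r2 < 1.
Proof. by rewrite divr_gt0 //= ltr_pdivrMr // mul1r. Qed.

Lemma rho_01 : 0 < rho < 1.
Proof.
have /andP[r1p r1l] := r1_01; have /andP[r2p r2l] := r2_01.
by rewrite /rho lt_max gt_max r1p r1l r2l.
Qed.

(** [r2 ^ m] has the right value on the line [m = 0] and satisfies the interior
    equation, but not the boundary equation; the correction
    [r1 ^ z.2 * gap_term m] repairs the latter and vanishes on the line. *)
Definition gap_term (m : int) : R := C * (r2 ^ m - r1 ^ m).

Definition hit_barX (n : nat) (z : site) : R :=
  r2 ^ (n%:Z - z.1 - z.2) + r1 ^ z.2 * gap_term (n%:Z - z.1 - z.2).

(** In the interior each of [r2 ^ m], [r1 ^ z.2 * r2 ^ m] and [r1 ^ (m + z.2)]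
    is harmonic by itself. On [z.2 = 0] only the third one still is; the defect
    [m2 - l] of the first and [m2 - m1] of the second, weighted by [C], cancel. *)
Lemma hit_barX_harmonic n a b : 0 <= b ->
  mean nu upper_half (hit_barX n) (a, b) = hit_barX n (a, b).
Proof.
move=> b0; rewrite mean_upper // /hit_barX /gap_term /=.
have /andP[r1p _] := r1_01; have /andP[r2p _] := r2_01.
rewrite (_ : n%:Z - (a + 1) - b = n%:Z - a - b - 1); last by lia.
rewrite (_ : n%:Z - (a - 1) - (b + 1) = n%:Z - a - b); last by lia.
rewrite (_ : n%:Z - a - (b - 1) = n%:Z - a - b + 1); last by lia.
rewrite !exprz_succ ?exprz_pred //.
set p := r2 ^ _; set q := r1 ^ (n%:Z - a - b).
have m1N0 : m1 != 0 by rewrite gt_eqF.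
have m2N0 : m2 != 0 by rewrite gt_eqF.
have lN0 : l != 0 by rewrite gt_eqF.
have m12N0 : m1 - m2 != 0 by rewrite subr_eq0.
have lE : l = 1 - m1 - m2 by rewrite -sum1; ring.
have [->|b1] := int_ge0_cases b0.
  rewrite /= !expr0z.
  transitivity ((l + m1 + m2) * (p + 1 * (C * (p - q)))); last by rewrite sum1 mul1r.
  by rewrite /C /r1 /r2; field; rewrite ?m1N0 ?m2N0 ?lN0 ?m12N0.
rewrite b1; set s := r1 ^ b.
transitivity ((l + m1 + m2) * (p + s * (C * (p - q)))); last by rewrite sum1 mul1r.
by rewrite /C /r1 /r2; field; rewrite m1N0 m2N0 lN0 m12N0.
Qed.

Lemma le_rho_exp (m : nat) : (r1 ^+ m <= rho ^+ m) /\ (r2 ^+ m <= rho ^+ m).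
Proof.
have /andP[r1p _] := r1_01; have /andP[r2p _] := r2_01.
have rho_ge0 : 0 <= rho by rewrite le_max (ltW r1p).
by split; apply: lerXn2r; rewrite ?nnegrE ?(ltW r1p) ?(ltW r2p) //
  le_max lexx ?orbT.
Qed.

(** [C] and [r2 - r1] have the same sign, that of [m1 - m2]. *)
Lemma gap_term_bounds (m : int) : 0 <= m ->
  0 <= gap_term m <= `|C| * rho ^ m.
Proof.
case: m => // m _; rewrite /gap_term -!exprnP.
have /andP[r1p _] := r1_01; have /andP[r2p _] := r2_01.
have [h1 h2] := le_rho_exp m.
have [lt12|lt21|/eqP] := ltgtP m1 m2; last by rewrite (negPf m12).
- have r12 : r2 <= r1 by rewrite /r1 /r2 ler_pM2l // lef_pV2 ?posrE // ltW.
  have C0 : C <= 0.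
    by rewrite mulr_ge0_le0 ?subr_ge0 ?invr_le0 ?subr_le0 ?(ltW lm2) ?(ltW lt12).
  have : r2 ^+ m <= r1 ^+ m by rewrite lerXn2r // nnegrE ltW.
  have : 0 < r2 ^+ m by rewrite exprn_gt0.
  by rewrite ler0_norm //; nra.
- have r21 : r1 <= r2 by rewrite /r1 /r2 ler_pM2l // lef_pV2 ?posrE // ltW.
  have C0 : 0 <= C by rewrite divr_ge0 ?subr_ge0 ?(ltW lm2) ?(ltW lt21).
  have : r1 ^+ m <= r2 ^+ m by rewrite lerXn2r // nnegrE ltW.
  have : 0 < r1 ^+ m by rewrite exprn_gt0.
  by rewrite ger0_norm //; nra.
Qed.

Lemma hit_barX_bounds n a b : 0 <= b -> a + b <= n%:Z ->
  0 <= hit_barX n (a, b) <= (1 + `|C|) * rho ^ (n%:Z - a - b).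
Proof.
move=> b0 abn; rewrite /hit_barX /=.
have m0 := gap_ge0 abn.
have /andP[g0 gle] := gap_term_bounds m0.
have /andP[r1p r1l] := r1_01; have /andP[r2p r2l] := r2_01.
have s1 : r1 ^ b <= 1.
  case: b b0 {abn m0 g0 gle} => // b _.
  by rewrite -exprnP exprn_ile1 // ltW.
have s0 : 0 < r1 ^ b by rewrite exprz_gt0.
have p0 : 0 < r2 ^ (n%:Z - a - b) by rewrite exprz_gt0.
have pr : r2 ^ (n%:Z - a - b) <= rho ^ (n%:Z - a - b).
  by case: (n%:Z - a - b) m0 => // m _; rewrite -!exprnP; case: (le_rho_exp m).
apply/andP; split; first by apply: addr_ge0; [exact: ltW|rewrite mulr_ge0 // ltW].
rewrite mulrDl mul1r lerD //; apply: le_trans gle.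
by rewrite ler_piMl.
Qed.

(** If [r1 < r2] the term [r2 ^ m] suffices. If [r2 < r1] the dominant term is
    [- C * r1 ^ (m + z.2)], of which [r2 ^ m <= r2 / r1 * r1 ^ m] leaves the
    fraction [1 - r2 / r1]; here [m >= 1] is needed, and
    [- C * (1 - r2 / r1) = 1 - r2]. *)
Lemma hit_barX_ge n a b : 0 <= b -> a + b < n%:Z ->
  (1 - r2) * rho ^ (n%:Z - a) <= hit_barX n (a, b).
Proof.
move=> b0 abn; rewrite /hit_barX /=.
have /andP[r1p r1l] := r1_01; have /andP[r2p r2l] := r2_01.
rewrite (gap_split n%:Z a b).
have m0 := gap_gt0 abn.
have /andP[g0 _] := gap_term_bounds (le_trans ler01 m0).
have s0 : 0 < r1 ^ b by rewrite exprz_gt0.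
have p0 : 0 < r2 ^ (n%:Z - a - b) by rewrite exprz_gt0.
have q0 : 0 < r1 ^ (n%:Z - a - b) by rewrite exprz_gt0.
rewrite addrK expfzDr; last by rewrite gt_eqF //; case/andP: rho_01.
have [lt12|lt21|/eqP] := ltgtP m1 m2; last by rewrite (negPf m12).
- have r12 : r2 < r1 by rewrite /r1 /r2 ltr_pM2l // ltf_pV2 ?posrE.
  rewrite /rho (max_idPl (ltW r12)).
  suff : (1 - r2) * r1 ^ (n%:Z - a - b) <= gap_term (n%:Z - a - b) by nra.
  have : r2 ^ (n%:Z - a - b) <= r2 / r1 * r1 ^ (n%:Z - a - b).
    case: (n%:Z - a - b) m0 => // -[//|m] _; rewrite -!exprnP !exprS.
    rewrite mulrA divfK ?gt_eqF // ler_pM2l // lerXn2r // ?nnegrE ltW //.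
  rewrite /gap_term; set p := r2 ^ _; set q := r1 ^ _.
  have -> : (1 - r2) * q = C * (r2 / r1 * q - q).
    have m1N0 : m1 != 0 by rewrite gt_eqF.
    have m2N0 : m2 != 0 by rewrite gt_eqF.
    have lN0 : l != 0 by rewrite gt_eqF.
    have m12N0 : m1 - m2 != 0 by rewrite subr_eq0.
    by rewrite /C /r1 /r2; field; rewrite ?m1N0 ?m2N0 ?lN0 ?m12N0.
  have C0 : C <= 0.
    by rewrite mulr_ge0_le0 ?subr_ge0 ?invr_le0 ?subr_le0 ?(ltW lm2) ?(ltW lt12).
  by move=> pq; rewrite ler_wnM2l // lerB.
- have r21 : r1 < r2 by rewrite /r1 /r2 ltr_pM2l // ltf_pV2 ?posrE.
  rewrite /rho (max_idPr (ltW r21)).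
  have s1 : r2 ^ b <= 1.
    case: b b0 {abn m0 g0 s0 p0 q0} => // b _.
    by rewrite -exprnP exprn_ile1 // ltW.
  have s0' : 0 < r2 ^ b by rewrite exprz_gt0.
  apply: (@le_trans _ _ (r2 ^ (n%:Z - a - b))); last first.
    by rewrite lerDl mulr_ge0 // ltW.
  rewrite mulrCA -[leRHS]mulr1 ler_pM2l //; nra.
Qed.

Lemma hit_barX_line n a b : a + b = n%:Z -> hit_barX n (a, b) = 1.
Proof.
move=> abn; rewrite /hit_barX /gap_term /= (_ : _ - b = 0); last by lia.
by rewrite !expr0z subrr !mulr0 addr0.
Qed.

(** The defect of [f] for [X] on the axis: the suppressed step would have led
    from the first site to the second one. *)
Lemma hit_barX_axis n b : 0 <= b ->
  hit_barX n (0, b) - hit_barX n (-1, b + 1) =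
  (1 - r1) * (r1 ^ b * gap_term (n%:Z - b)).
Proof.
move=> b0; rewrite /hit_barX /=.
have -> : n%:Z - -1 - (b + 1) = n%:Z - 0 - b by lia.
by rewrite subr0 exprz_succ; [ring|case/andP: r1_01].
Qed.

(** On the axis the gap is [n - b], so the factors [r1 ^ b] and
    [gap_term (n - b)] of the defect multiply to at most [`|C| * rho ^ n],
    uniformly in [b]. *)
Lemma hit_barX_mean_quadrant n a b : 0 <= a -> 0 <= b -> a + b <= n%:Z ->
  hit_barX n (a, b) <= mean nu quadrant (hit_barX n) (a, b) <=
  hit_barX n (a, b) + `|C| * rho ^ n.
Proof.
move=> a0 b0 abn.
have harm := hit_barX_harmonic n a b0; rewrite mean_upper // in harm.
have /andP[rhop _] := rho_01.
rewrite mean_quadrant //; have [a00|a1] := int_ge0_cases a0; last first.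
  by rewrite a1 harm lexx lerDl mulr_ge0 // ltW // exprz_gt0.
subst a; rewrite /= sub0r in harm *.
have m0 : 0 <= n%:Z - b by lia.
have /andP[g0 gle] := gap_term_bounds m0.
have := hit_barX_axis n b0; set t := hit_barX n (0, b) in harm *.
set t' := hit_barX n (-1, b + 1) in harm *.
have /andP[r1p r1l] := r1_01.
have s0 : 0 < r1 ^ b by rewrite exprz_gt0.
have sr : r1 ^ b <= rho ^ b.
  case: b b0 {abn harm m0 g0 gle t t' s0} => // b _.
  by rewrite -!exprnP; case: (le_rho_exp b).
have defect : r1 ^ b * gap_term (n%:Z - b) <= `|C| * rho ^ n.
  have -> : rho ^ n = rho ^ b * rho ^ (n%:Z - b).
    by rewrite -expfzDr ?gt_eqF // addrC subrK.
  by rewrite [leRHS]mulrCA; apply: ler_pM => //; exact: ltW.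
have D0 : 0 <= r1 ^ b * gap_term (n%:Z - b) by rewrite mulr_ge0 // ltW.
move: (r1 ^ b * _) D0 defect => D D0 defect tt'.
set u := _ + m2 * _; have -> : u = t + m1 * (t - t').
  by move: harm; rewrite /u; set v := (if _ then _ else _) => <-; ring.
rewrite tt'; have m1l := m1_lt1.
have : 0 <= m1 * ((1 - r1) * D) <= D.
  apply/andP; split; first by rewrite mulr_ge0 ?mulr_ge0 // ?subr_ge0 ltW.
  rewrite mulrA ler_piMl // mulr_ile1 ?subr_ge0 ?(ltW m1l) ?(ltW r1l) ?(ltW m1_gt0) //.
  by rewrite gerBl ltW.
by move=> /andP[e0 eD]; rewrite lerDl e0 lerD2l (le_trans eD).
Qed.

Lemma mean_cst D (c : R) z : mean nu D (fun=> c) z = c.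
Proof.
by rewrite /mean -mulr_suml !big_cons big_nil /= addr0 addrA sum1 mul1r.
Qed.

(** Up to the factor [beta ^ n] these are the powers [beta ^ m] and
    [beta ^ (m + z.2)], both strictly superharmonic in the interior when
    [rho < beta < 1]. *)
Definition lyap (beta D : R) (z : site) : R :=
  beta ^ (- z.1 - z.2) + D * beta ^ (- z.1).

(** The first power fails to be superharmonic on [z.2 = 0]; the second one does
    not, so a large multiple [D] of it absorbs the excess there. *)
Lemma lyap_barX beta : rho < beta < 1 -> exists kap D : R,
  [/\ 0 <= kap < 1, 0 <= D & forall a b, 0 <= b ->
      mean nu upper_half (lyap beta D) (a, b) <= kap * lyap beta D (a, b)].
Proof.
move=> /andP[rb b1].
have b0 : 0 < beta by apply: lt_trans rb; case/andP: rho_01.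
move: rb; rewrite gt_max => /andP[r1b r2b].
have lb1 : l / beta < m1 by rewrite ltr_pdivrMr // mulrC -ltr_pdivrMr.
have lb2 : l / beta < m2 by rewrite ltr_pdivrMr // mulrC -ltr_pdivrMr.
pose k0 := l / beta + m1 + m2.
pose k1 := l / beta + m1 + m2 * beta.
pose k2 := l / beta + m1 * beta + m2.
have lb : l = l / beta * beta by rewrite divfK // gt_eqF.
have lb0 : 0 < l / beta by rewrite divr_gt0.
have k1l : k1 < 1.
  rewrite /k1; move: lb lb2 lb0 b0 b1 sum1; move: (l / beta) => t; nra.
have k2l : k2 < 1.
  rewrite /k2; move: lb lb1 lb0 b0 b1 sum1; move: (l / beta) => t; nra.
have k2p : 0 < k2 by rewrite /k2 addr_gt0 // addr_gt0 // mulr_gt0.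
have k0p : 0 < k0 by rewrite /k0 !addr_gt0.
pose kap := Num.max k1 ((1 + k2) / 2).
have kapl : kap < 1 by rewrite gt_max k1l ltr_pdivrMr // mul1r; lra.
have kap1 : k1 <= kap by rewrite le_max lexx.
have kap2 : (1 + k2) / 2 <= kap by rewrite le_max lexx orbT.
(* half of the margin [1 - k2] is left for the excess [k0] on the boundary *)
pose D := 2 * k0 / (1 - k2).
have D0 : 0 <= D by rewrite divr_ge0 ?subr_ge0 ?mulr_ge0 // ltW.
exists kap, D; split => //; first by rewrite kapl andbT; lra.
move=> a b bge0; rewrite mean_upper // /lyap /=.
have [e1 e2 e3 e4 e5] := opp_step a b; rewrite e1 e2 e3 e4 e5.
rewrite !exprz_succ ?exprz_pred //.
have Q0 : 0 < beta ^ (- a) by rewrite exprz_gt0.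
have P0 : 0 < beta ^ (- a - b) by rewrite exprz_gt0.
have [->|b1'] := int_ge0_cases bge0.
  rewrite /= !subr0; set Q := beta ^ (- a).
  suff : k0 + D * k2 <= kap * (1 + D).
    move=> kk; rewrite [leLHS](_ : _ = (k0 + D * k2) * Q).
      by rewrite [leRHS](_ : _ = kap * (1 + D) * Q) ?ler_pM2r //; ring.
    by rewrite /k0 /k2; field; rewrite gt_eqF.
  have DE : D * (1 - k2) = 2 * k0 by rewrite /D divfK // gt_eqF // subr_gt0.
  have : (1 + k2) / 2 * (1 + D) <= kap * (1 + D).
    by rewrite ler_wpM2r // addr_ge0.
  by clearbody D; move: DE k2p; lra.
rewrite b1'; move: Q0 P0; set Q := beta ^ (- a); set P := beta ^ _ => Q0 P0.
rewrite [leLHS](_ : _ = k1 * P + k2 * (D * Q)); last first.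
  by rewrite /k1 /k2; field; rewrite gt_eqF.
rewrite mulrDr lerD //; first by rewrite ler_pM2r.
by rewrite ler_wpM2r //; [rewrite mulr_ge0 // ltW|lra].
Qed.

(** The exponent [z.2 + 2 z.1] is the number of services that the customers
    present still require: a service lowers it by 1, an arrival raises it by 2. *)
Definition tail_weight (z : site) : R := 2^-1 ^ (z.2 + z.1 + z.1).

(** Off the origin at least one server is busy, and its service doubles the
    weight at a rate larger than [l], which outweighs the factor 1/4 that comes
    with an arrival. *)
Lemma tail_weight_drift a b : 0 <= a -> 0 <= b -> (a, b) != (0, 0) ->
  tail_weight (a, b) * (1 + l / 4) <= mean nu quadrant tail_weight (a, b).
Proof.
move=> a0 b0 ab; rewrite mean_quadrant // /tail_weight /=.
have [e1 e2 e3] := tail_step a b; rewrite e1 e2 e3.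
have h0 : 0 < 2^-1 :> R by rewrite invr_gt0.
rewrite !exprz_succ ?exprz_pred // invrK.
have : 0 < 2^-1 ^ (b + a + a) :> R by rewrite exprz_gt0.
have active : (1 <= a) || (1 <= b).
  have [a00|->//] := int_ge0_cases a0; have [b00|->] := int_ge0_cases b0.
    by rewrite a00 b00 eqxx in ab.
  by rewrite orbT.
move: active; set p := _ ^ _.
by case: ifP => _; case: ifP => _ //= _; move: sum1 lm1 lm2 m1_gt0 m2_gt0; nra.
Qed.

Lemma lyap_axis beta D b : 0 < beta ->
  lyap beta D (0, b) - lyap beta D (-1, b + 1) = D * (1 - beta).
Proof.
move=> b0; rewrite /lyap /= (_ : - (-1) - (b + 1) = - 0 - b); last by lia.
by rewrite oppr0 opprK expr0z expr1z; ring.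
Qed.

Lemma lyap_ge1 beta D a b : 0 < beta < 1 -> 0 <= D -> 0 <= a -> 0 <= b ->
  1 <= beta ^ (- a - b) <= lyap beta D (a, b) /\
  lyap beta D (a, b) <= (1 + D) * beta ^ (- a - b).
Proof.
move=> /andP[be0 be1] D0; case: a => // a _; case: b => // b _.
have bi : 1 <= beta^-1 by rewrite invf_ge1 // ltW.
have -> : - Posz a - Posz b = - Posz (a + b) by lia.
rewrite /lyap /= -opprD -PoszD -!exprnN -!exprVn.
split; last by rewrite mulrDl mul1r lerD2l ler_wpM2l // ler_weXn2l // leq_addr.
by rewrite exprn_ege1 //= lerDl mulr_ge0 // exprn_ge0 // (le_trans ler01).
Qed.

Lemma tail_weight_ge (beta : R) (N : nat) a b : 0 < beta < 1 ->
  0 <= a -> 0 <= b -> beta ^ (- a - b) * beta ^+ N < 1 ->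
  1 <= 2 ^+ (N + N) * tail_weight (a, b).
Proof.
move=> /andP[be0 be1]; case: a => // a _; case: b => // b _.
have -> : - Posz a - Posz b = - Posz (a + b) by lia.
rewrite -exprnN mulrC ltr_pdivrMr ?exprn_gt0 // mul1r.
rewrite /tail_weight /= -!PoszD -exprnP => lt_pow.
have abN : (a + b < N)%N.
  rewrite ltnNge; apply/negP => Nab; move: lt_pow; apply/negP; rewrite -leNgt.
  by rewrite ler_wiXn2l // ltW.
rewrite exprVn -ler_pdivrMr ?invr_gt0 ?exprn_gt0 // invrK mul1r.
by rewrite ler_weXn2l ?ler1n //; lia.
Qed.

(** For [X], [lyap] decreases in mean outside a finite set, but may increase near
    the origin, since the axis adds a bounded amount to its drift. The bounded
    function [1 - tail_weight], whose drift is strictly negative off the origin,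
    corrects this; the multiple [M] is chosen so that the correction wins on the
    sites where [lyap] is too small to do so. *)
Lemma lyap_X beta : rho < beta < 1 -> exists (K : R) (L : site -> R),
  (forall a b, 0 <= a -> 0 <= b ->
     1 <= L (a, b) <= K * beta ^ (- a - b)) /\
  (forall a b, 0 <= a -> 0 <= b -> (a, b) != (0, 0) ->
     mean nu quadrant L (a, b) <= L (a, b) - 1).
Proof.
move=> rb; have [kap [D [/andP[kap0 kap1] D0 barL]]] := lyap_barX rb.
have b01 : 0 < beta < 1.
  by case/andP: rb => rb ->; rewrite andbT (lt_trans _ rb) //; case/andP: rho_01.
have [be0 be1] := andP b01.
have XL a b : 0 <= a -> 0 <= b ->
    mean nu quadrant (lyap beta D) (a, b) <= kap * lyap beta D (a, b) + D.
  move=> a0 b0; have := barL a b b0; rewrite mean_upper // mean_quadrant //.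
  have [a00|->] := int_ge0_cases a0; last by move/le_trans; apply; rewrite lerDl.
  subst a; rewrite /= sub0r; have := lyap_axis D b be0.
  set t := lyap beta D (0, b); set t' := lyap beta D (-1, b + 1).
  move=> tt'; have : m1 * (t - t') <= D.
    rewrite tt' mulrCA ler_piMr // mulr_ile1 ?subr_ge0 ?(ltW be1) ?(ltW m1_lt1) //.
      exact: ltW.
    by rewrite gerBl ltW.
  set v := (if _ then _ else _); lra.
have k0 : 0 < (1 - kap) / (D + 1).
  by rewrite divr_gt0 ?subr_gt0 // ltr_wpDl.
have [N Nk] := exists_expr_lt b01 k0.
(* where [lyap] is too small, [a + b < N], so [tail_weight] is at least
   [2 ^- (N + N)] *)
pose M := (D + 1) * 4 / l * 2 ^+ (N + N).
have M0 : 0 <= M by rewrite !mulr_ge0 ?exprn_ge0 ?invr_ge0 ?addr_ge0 // ltW.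
exists (1 + D + M), (fun z => lyap beta D z + M * (1 + (-1) * tail_weight z)).
split=> a b a0 b0.
  have [/andP[P1 PL] LP] := lyap_ge1 b01 D0 a0 b0.
  have w01 : 0 < tail_weight (a, b) <= 1.
    rewrite /tail_weight exprz_gt0 ?invr_gt0 //=.
    have : 0 <= b + a + a by rewrite !addr_ge0.
    case: (b + a + a) => // w _; rewrite -exprnP exprn_ile1 ?invr_ge0 //.
    by rewrite invf_le1 // ler1n.
  move: w01 => /andP[w0 w1].
  have Mw : 0 <= M * (1 + -1 * tail_weight (a, b)).
    by rewrite mulr_ge0 // mulN1r subr_ge0.
  apply/andP; split; first by rewrite (le_trans P1) // (le_trans PL) // lerDl.
  rewrite mulrDl lerD // (@le_trans _ _ M) //.
    by rewrite ler_piMr // mulN1r lerBlDr lerDl ltW.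
  by rewrite ler_peMr.
move=> ab; rewrite mean_lin (mean_lin nu quadrant (fun=> 1)) mean_cst.
have := XL a b a0 b0; have := tail_weight_drift a0 b0 ab.
have [/andP[P1 PL] _] := lyap_ge1 b01 D0 a0 b0.
set t := tail_weight (a, b); set mt := mean _ _ tail_weight _.
set H := lyap _ _ _ in PL *; set mH := mean _ _ (lyap _ _) _ => tm HH.
suff : D + 1 <= (1 - kap) * H + M * (t * (l / 4)).
  have : M * (t * (1 + l / 4)) <= M * mt by rewrite ler_wpM2l.
  lra.
have t0 : 0 < t by rewrite exprz_gt0 ?invr_gt0.
have [small|large] := leP (D + 1) ((1 - kap) * H).
  by rewrite (le_trans small) // lerDl mulr_ge0 // mulr_ge0 ?divr_ge0 // ltW.
(* [large] bounds [beta ^ (- a - b)], hence puts [(a, b)] within distance [N]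
   of the origin *)
have tN : 1 <= 2 ^+ (N + N) * t.
  apply: (@tail_weight_ge beta) => //.
  have k1p : 0 < 1 - kap by rewrite subr_gt0.
  have D1p : 0 < D + 1 by rewrite ltr_wpDl.
  have lt1 : beta ^ (- a - b) * ((1 - kap) / (D + 1)) < 1.
    rewrite mulrA ltr_pdivrMr // mul1r mulrC.
    by apply: le_lt_trans large; rewrite ler_pM2l.
  apply: lt_trans lt1; rewrite ltr_pM2l //.
  exact: lt_le_trans ltr01 P1.
have -> : M * (t * (l / 4)) = (D + 1) * (2 ^+ (N + N) * t).
  by rewrite /M; field; rewrite gt_eqF.
rewrite (@le_trans _ _ ((D + 1) * (2 ^+ (N + N) * t))) //.
  by rewrite ler_peMr // addr_ge0.
rewrite lerDr mulr_ge0 ?subr_ge0 ?(ltW kap1) //.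
by rewrite (le_trans _ PL) // (le_trans ler01).
Qed.

Lemma tandem_law_ge0 s : s \in nu -> 0 <= s.2.
Proof. by rewrite !inE => /or3P[] /eqP -> /=; exact: ltW. Qed.

Lemma step_below (D : pred site) (n : nat) z s :
  D z -> z.1 + z.2 <= n%:Z -> z.1 + z.2 != n%:Z -> s \in nu ->
  D (z + constrained_step D z s.1) /\
  (z + constrained_step D z s.1).1 + (z + constrained_step D z s.1).2 <= n%:Z.
Proof.
rewrite add_constrained_stepE => Dz le_n ne_n; case: ifP => // Dzs snu; split=> //.
have lt_n : z.1 + z.2 < n%:Z by rewrite lt_neqAle ne_n.
by move: snu; rewrite !inE => /or3P[] /eqP -> /=; lia.
Qed.

(** Upper bound by [reach_prob_le], as [f] is harmonic and nonnegative; lower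
    bound by [reach_prob_ge], with any [beta] between [rho] and 1. *)
Lemma barX_limit (n : nat) (a b : int) (p : R) : 0 <= b -> a + b <= n%:Z ->
  (fun k => reach_prob nu upper_half [pred y | y.1 + y.2 == n%:Z] pred0 k (a, b))
    @ \oo --> p ->
  p = hit_barX n (a, b).
Proof.
move=> b0 abn up; have /andP[rho0 rho1] := rho_01.
pose G : pred site := fun z => (0 <= z.2) && (z.1 + z.2 <= n%:Z).
have Gab : G (a, b) by rewrite /G b0.
have Gstep z s : G z -> ~~ (z.1 + z.2 == n%:Z) -> ~~ pred0 z -> s \in nu ->
    G (z + constrained_step upper_half z s.1).
  move=> /andP[z0 zn] zneq _ snu.
  by apply/andP; exact: (@step_below upper_half).
apply/eqP; rewrite eq_le; apply/andP; split.
  apply: (cvg_le_of_bound up) => k.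
  apply: (reach_prob_le tandem_law_ge0 Gstep) => // -[x y] /andP[/= y0 xyn].
  - by have /andP[] := hit_barX_bounds y0 xyn.
  - by move=> /eqP xy; rewrite hit_barX_line.
  - by move=> _ _; rewrite hit_barX_harmonic.
have rb : rho < (rho + 1) / 2 < 1 by apply/andP; split; lra.
have [kap [D [kap01 D0 barL]]] := lyap_barX rb.
have beta0 : 0 < (rho + 1) / 2 by lra.
set beta := (rho + 1) / 2 in rb barL beta0.
pose c := (1 + `|C|) * beta ^ n%:Z.
have c0 : 0 <= c by rewrite mulr_ge0 ?addr_ge0 // ltW // exprz_gt0.
have lyap0 z : 0 <= lyap beta D z.
  by rewrite addr_ge0 ?mulr_ge0 // ltW // exprz_gt0.
apply: (cvg_ge_of_geometric up kap01
  (h := 0 + c * lyap beta D (a, b))) => k.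
apply: (reach_prob_ge tandem_law_ge0 Gstep (h := fun z => 0 + c * lyap beta D z)) => //.
- by case/andP: kap01.
- by move=> z _; rewrite add0r mulr_ge0.
- move=> [x y] /andP[/= y0 xyn]; rewrite add0r /lyap /= mulrDr.
  have /andP[_ /le_trans] := hit_barX_bounds y0 xyn; apply.
  rewrite (@le_trans _ _ (c * beta ^ (- x - y))) ?lerDl //; last first.
    by rewrite !mulr_ge0 // ltW // exprz_gt0.
  rewrite /c -mulrA -expfzDr ?gt_eqF // addrA ler_wpM2l ?addr_ge0 //.
  have := gap_ge0 xyn.
  case: (n%:Z - x - y) => // m _.
  rewrite -!exprnP lerXn2r ?nnegrE ?(ltW rho0) ?(ltW beta0) //.
  by case/andP: rb => /ltW.
- by move=> [x y] _ /eqP xy; rewrite hit_barX_line.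
- by move=> [x y] /andP[/= y0 xyn] _ _; rewrite hit_barX_harmonic.
- move=> [x y] /andP[/= y0 xyn] _ _; rewrite mean_lin mean_cst !add0r mulrCA.
  by rewrite ler_wpM2l // barL.
Qed.

(** The lower bound uses that [f] minus its bound at the origin is subharmonic,
    with [L] as the contracted majorant: a drift of -1 is a contraction on a set
    where [L] is bounded. The upper bound adds to [f] a multiple of [L], whose
    drift pays for the defect of [f] on the axis. *)
Lemma X_limit_bounds beta : rho < beta < 1 -> exists K : R, 1 <= K /\
  forall (n : nat) (a b : int) (p : R), 0 <= a -> 0 <= b -> a + b <= n%:Z ->
  (fun k => reach_prob nu quadrant [pred y | y.1 + y.2 == n%:Z]
              (pred1 (0, 0)) k (a, b)) @ \oo --> p ->
  hit_barX n (a, b) - (1 + `|C|) * rho ^ n <= p <=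
  hit_barX n (a, b) + (1 + `|C|) * rho ^ n * (K * beta ^ (- n%:Z)).
Proof.
move=> rb; have [K [L [Lbd Ldrift]]] := lyap_X rb.
have /andP[rho0 rho1] := rho_01.
have /andP[rhob beta1] := rb.
have beta0 : 0 < beta by exact: lt_trans rhob.
have K1 : 1 <= K by have /andP[/le_trans h /h] := Lbd 0 0 (lexx 0) (lexx 0);
  rewrite subr0 oppr0 expr0z mulr1.
have K0 : 0 < K by exact: lt_le_trans K1.
exists K; split=> // n a b p a0 b0 abn up.
pose G : pred site := fun z => quadrant z && (z.1 + z.2 <= n%:Z).
have Gab : G (a, b) by rewrite /G /quadrant /= a0 b0.
have Gstep z s : G z -> ~~ (z.1 + z.2 == n%:Z) -> ~~ pred1 (0, 0) z ->
    s \in nu -> G (z + constrained_step quadrant z s.1).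
  move=> /andP[z0 zn] zneq _ snu.
  by apply/andP; exact: (@step_below quadrant).
pose Lmax := K * beta ^ (- n%:Z).
have LG x y : G (x, y) -> 1 <= L (x, y) <= Lmax.
  move=> /andP[/andP[/= x0 y0] xyn].
  have /andP[-> /le_trans] := Lbd x y x0 y0; apply.
  rewrite ler_pM2l //.
  have := gap_ge0 xyn.
  rewrite (opp_gap n%:Z x y).
  rewrite expfzDr ?gt_eqF //; case: (_ - y) => // m _.
  by rewrite -exprnP ler_piMr ?exprn_ile1 ?(ltW beta0) ?(ltW beta1) // ltW // exprz_gt0.
have Lmax1 : 1 <= Lmax by have /andP[/le_trans] := LG a b Gab; exact.
have Lmax0 : 0 < Lmax by exact: lt_le_trans Lmax1.
pose c := (1 + `|C|) * rho ^ n.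
have C1 : 0 < 1 + `|C| by rewrite ltr_wpDr.
have c0 : 0 < c by rewrite mulr_gt0 // exprz_gt0.
rewrite -/Lmax -/c; apply/andP; split.
  apply: (cvg_ge_of_geometric up (kap := 1 - Lmax^-1)
      (h := 0 + (1 + `|C|) * L (a, b))) => [|k].
    by rewrite subr_ge0 invf_le1 // Lmax1 gtrBl invr_gt0.
  rewrite -[X in _ - X]mulr1 -mulNr.
  apply: (reach_prob_ge tandem_law_ge0 Gstep (g := fun z => hit_barX n z + (- c) * 1)
    (h := fun z => 0 + (1 + `|C|) * L z)).
  - by rewrite subr_ge0 invf_le1.
  - move=> [x y] /LG /andP[L1 _]; rewrite add0r mulr_ge0 // ?(ltW C1) //.
    exact: le_trans L1.
  - move=> [x y] Gxy; have /andP[L1 _] := LG x y Gxy.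
    move: Gxy => /andP[/andP[/= x0 y0] xyn]; rewrite add0r mulr1 lerBlDr.
    rewrite (@le_trans _ _ ((1 + `|C|) * L (x, y))) ?lerDl ?(ltW c0) //.
    have /andP[_ /le_trans] := hit_barX_bounds y0 xyn; apply.
    rewrite ler_pM2l // (le_trans _ L1) //.
    have := gap_ge0 xyn; case: (_ - y) => // m _.
    by rewrite -exprnP exprn_ile1 // ltW.
  - move=> [x y] _ /eqP xy; rewrite hit_barX_line // mulr1 gerBl ltW //.
  - move=> z _ /eqP ->; rewrite mulr1 subr_le0.
    have /andP[_ /le_trans] := @hit_barX_bounds n 0 0 (lexx 0) isT; apply.
    by rewrite !subr0 lexx.
  - move=> [x y] /andP[/andP[/= x0 y0] xyn] _ _.
    rewrite (mean_lin nu quadrant (hit_barX n) (fun=> 1)) mean_cst lerD2r.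
    by have /andP[] := hit_barX_mean_quadrant x0 y0 xyn.
  - move=> [x y] Gxy _ xy0; have /andP[L1 LM] := LG x y Gxy.
    move: Gxy => /andP[/andP[/= x0 y0] xyn].
    rewrite (mean_lin nu quadrant (fun=> 0) L) mean_cst !add0r mulrCA.
    rewrite ler_pM2l // (le_trans (Ldrift x y x0 y0 xy0)) // mulrBl mul1r.
    by rewrite lerD2l lerN2 mulrC ler_pdivrMr // mul1r.
  - exact: Gab.
apply: (@le_trans _ _ (hit_barX n (a, b) + c * L (a, b))); last first.
  by rewrite lerD2l ler_pM2l //; have /andP[] := LG a b Gab.
apply: (cvg_le_of_bound up) => k.
apply: (reach_prob_le tandem_law_ge0 Gstep (psi := fun z => hit_barX n z + c * L z)) => //.
- move=> [x y] Gxy; have /andP[L1 _] := LG x y Gxy.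
  move: Gxy => /andP[/andP[/= x0 y0] xyn].
  apply: addr_ge0; last first.
    by apply: mulr_ge0; [exact: ltW|exact: le_trans L1].
  by have /andP[] := hit_barX_bounds y0 xyn.
- move=> [x y] Gxy /eqP xy; rewrite hit_barX_line // lerDl; apply: mulr_ge0.
    exact: ltW.
  by have /andP[L1 _] := LG x y Gxy; exact: le_trans L1.
- move=> [x y] Gxy _ xy0; move: Gxy => /andP[/andP[/= x0 y0] xyn].
  rewrite mean_lin.
  have /andP[_ fle] := hit_barX_mean_quadrant x0 y0 xyn.
  have LD : c * mean nu quadrant L (x, y) <= c * (L (x, y) - 1).
    by rewrite ler_pM2l //; exact: Ldrift.
  apply: (le_trans (lerD fle LD)).
  rewrite mulrBr mulr1 -addrA lerD2l addrCA gerDl subr_le0.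
  by rewrite /c mulrDl mul1r lerDr ltW // exprz_gt0.
Qed.

(** The bound is of order [rho ^ a * beta ^ (- n)] with [a >= n * x1 - 1]: the choice
    [beta = rho ^ (x1 / 2)] spends half of the gain [rho ^ a] on the factor
    [beta ^ (- n)], and half of what remains absorbs the constant [K4]. *)
Lemma X_relative_error (x1 : R) : 0 < x1 < 1 -> exists (c : R) (N : nat),
  [/\ 0 < c, (0 < N)%N &
  forall (n : nat) (a b : int) (p : R), (N < n)%N -> 0 <= a -> 0 <= b ->
  a + b < n%:Z -> n%:R * x1 - 1 <= a%:~R ->
  (fun k => reach_prob nu quadrant [pred y | y.1 + y.2 == n%:Z]
              (pred1 (0, 0)) k (a, b)) @ \oo --> p ->
  0 < p /\ `|p - hit_barX n (a, b)| / p <= expR (- c * n%:R)].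
Proof.
move=> /andP[x0 x_lt1]; have /andP[rho0 rho1] := rho_01.
have /andP[_ r2l] := r2_01.
pose ga := - ln rho.
have ga0 : 0 < ga by rewrite oppr_gt0 ln_lt0 // rho0.
have rhoE : rho = expR (- ga) by rewrite opprK lnK.
pose beta := expR (- (ga * x1 / 2)).
have rb : rho < beta < 1.
  rewrite expR_lt1 rhoE ltr_expR ltrN2 oppr_lt0 !mulr_gt0 // andbT.
  by rewrite -mulrA gtr_pMr // ltr_pdivrMr // mul1r (lt_trans x_lt1) // ltr1n.
have [K [K1 bounds]] := X_limit_bounds rb.
have K0 : 0 < K by exact: lt_le_trans K1.
have C1 : 0 < 1 + `|C| by rewrite ltr_wpDr.
have r2' : 0 < 1 - r2 by rewrite subr_gt0.
pose c := ga * x1 / 4.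
have c0 : 0 < c by rewrite !mulr_gt0.
pose K4 := 2 * (1 + `|C|) * K * expR ga / (1 - r2).
have K40 : 0 < K4 by rewrite divr_gt0 // !mulr_gt0 // expR_gt0.
pose N := (Num.truncn (K4 / c)).+1.
exists c, N; split=> // n a b p Nn a0 b0 abn an up.
have K4n : K4 <= expR (c * n%:R).
  have : K4 < c * n%:R.
    rewrite mulrC -ltr_pdivrMr // (lt_le_trans (truncnS_gt _)) //.
    by rewrite ler_nat ltnW.
  move/ltW/le_trans; apply; apply: le_trans (expR_ge1Dx _).
  by rewrite lerDr.
have rho_a : rho ^ a <= expR (- ga * (n%:R * x1 - 1)).
  case: a a0 {up abn} an => // a _ an.
  have {}an : ga * (n%:R * x1 - 1) <= ga * a%:R by rewrite ler_pM2l.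
  rewrite -exprnP rhoE -expRM_natl ler_expR.
  by move: an; clearbody ga; lra.
have beta_n : beta ^ (- n%:Z) = expR (n%:R * (ga * x1 / 2)).
  by rewrite -exprnN -exprVn -expRN opprK -expRM_natl.
have f_ge := hit_barX_ge b0 abn.
have /andP[p_ge p_le] := bounds n a b p a0 b0 (ltW abn) up.
set f := hit_barX n (a, b) in f_ge p_ge p_le *.
have f0 : 0 < f by apply: lt_le_trans f_ge; rewrite mulr_gt0 // exprz_gt0.
pose E := (1 + `|C|) * rho ^ n * (K * beta ^ (- n%:Z)).
apply: (@relative_error _ _ _ E) => //.
- rewrite ler_norml; apply/andP; split; last by rewrite lerBlDl.
  rewrite lerBrDl; apply: le_trans p_ge; rewrite lerD2l lerN2 /E.
  rewrite ler_peMr ?mulr_ge0 ?(ltW C1) //; first by rewrite ltW // exprz_gt0.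
  rewrite beta_n mulr_ege1 // -expR0 ler_expR.
  by rewrite mulr_ge0 // ltW // !mulr_gt0.
- apply: (@le_trans _ _ (expR (- c * n%:R) * ((1 - r2) * rho ^ (n%:Z - a)))).
    have -> : E = rho ^ (n%:Z - a) * ((1 + `|C|) * K * (rho ^ a * beta ^ (- n%:Z))).
      rewrite /E; have -> : rho ^ n = rho ^ (n%:Z - a) * rho ^ a.
        by rewrite -expfzDr ?gt_eqF // subrK.
      by ring.
    have eK : K4 * expR (- c * n%:R) <= 1.
      by rewrite mulNr expRN ler_pdivrMr ?expR_gt0 // mul1r.
    have Te : rho ^ a * beta ^ (- n%:Z) <=
        expR ga * (expR (- c * n%:R) * expR (- c * n%:R)).
      rewrite beta_n; apply: le_trans (ler_wpM2r (expR_ge0 _) rho_a) _.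
      by rewrite -!expRD ler_expR /c; lra.
    rewrite [leRHS]mulrCA [leLHS]mulrCA [leRHS]mulrA [leRHS]mulrC.
    rewrite ler_pM2l ?exprz_gt0 //.
    move: (expR_ge0 (- c * n%:R)) eK Te; set e := expR (- c * n%:R).
    move: (rho ^ a * _) => T e0 eK Te.
    apply: (@le_trans _ _ (2 * ((1 + `|C|) * K * (expR ga * (e * e))))).
      by rewrite ler_pM2l // ler_pM2l ?mulr_gt0.
    have -> : 2 * ((1 + `|C|) * K * (expR ga * (e * e))) =
        (1 - r2) * e * (K4 * e).
      by rewrite /K4; field; rewrite gt_eqF.
    by rewrite ler_piMr // mulr_ge0 // ltW.
  by rewrite ler_pM2l // expR_gt0.
- by rewrite expR_ge0 expR_le1 mulNr oppr_le0 mulr_ge0 // ltW.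
Qed.

End Tandem.

(** * The exponential decay of the relative error *)

Theorem proposition4p1 (R : realType) (lambda mu1 mu2 : R)
    (hlambda : 0 < lambda) (hmu1 : 0 < mu1) (hmu2 : 0 < mu2)
    (hsum : lambda + mu1 + mu2 = 1)
    (hlambda1 : lambda < mu1) (hlambda2 : lambda < mu2) (hmu : mu1 <> mu2)
    (d d' : measure_display)
    (Om : measurableType d) (P : probability Om R)
    (I : nat -> {RV P >-> site})
    (hI : iid_steps I (1, 0) (-1, 1) (0, -1) lambda mu1 mu2)
    (Om' : measurableType d') (Q : probability Om' R)
    (J : nat -> {RV Q >-> site})
    (hJ : iid_steps J (-1, 0) (1, 1) (0, -1) lambda mu1 mu2)
    (x : R * R) (hx1 : 0 < x.1) (hx2 : 0 <= x.2)
    (hx0 : 0 < x.1 + x.2) (hx : x.1 + x.2 < 1) :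
  (forall n : nat,
     `|prob_X I n (scaled_floor n x) - prob_Y J (T_ n (scaled_floor n x))|
       / prob_X I n (scaled_floor n x) =
     `|prob_X I n (scaled_floor n x) - prob_barX I n (scaled_floor n x)|
       / prob_X I n (scaled_floor n x)) /\
  (exists (c : R) (N : nat), 0 < c /\ (0 < N)%N /\
     forall n : nat, (N < n)%N ->
       0 < prob_X I n (scaled_floor n x) /\
       `|prob_X I n (scaled_floor n x) - prob_Y J (T_ n (scaled_floor n x))|
         / prob_X I n (scaled_floor n x) <= expR (- c * n%:R)).
Proof.
have YE n z : prob_Y J (T_ n z) = prob_barX I n z := prob_YE hsum hI hJ n z.
split=> [n|]; first by rewrite YE.
have x1_01 : 0 < x.1 < 1 by rewrite hx1 /=; lra.
have m12 : mu1 != mu2 by exact/eqP.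
have [c [N [c0 N0 err]]] :=
  X_relative_error hlambda hmu1 hmu2 hsum hlambda1 hlambda2 m12 x1_01.
exists c, N; split=> //; split=> // n Nn; rewrite YE.
have n0 : 0 < n%:R :> R by rewrite ltr0n (leq_ltn_trans _ Nn).
have a0 : 0 <= Num.floor (n%:R * x.1) by rewrite floor_ge0 mulr_ge0 ?ltW.
have b0 : 0 <= Num.floor (n%:R * x.2) by rewrite floor_ge0 mulr_ge0 // ltW.
have abn : Num.floor (n%:R * x.1) + Num.floor (n%:R * x.2) < n%:Z.
  rewrite -(ltr_int R) intrD.
  apply: (@le_lt_trans _ _ (n%:R * x.1 + n%:R * x.2)).
    by rewrite lerD ?floor_le.
  by rewrite -mulrDr gtr_pMr.
have an : n%:R * x.1 - 1 <= (Num.floor (n%:R * x.1))%:~R.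
  by rewrite lerBlDr -intrD1 ltW // floorD1_gt.
rewrite (barX_limit hlambda hmu1 hmu2 hsum hlambda1 hlambda2 m12 b0 (ltW abn)
  (prob_barX_cvg hI hsum isT (n := n) (z := scaled_floor n x))).
apply: (err _ _ _ _ Nn a0 b0 abn an).
exact: (prob_X_cvg hI hsum isT (n := n) (z := scaled_floor n x)).
Qed.
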